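(* For all integers $k,t\geq 2$, $\mathrm{ex}^*(n,\theta_{k,t})=O(n^{1+1/k})$; that is, there is a constant $C=C(k,t)$ such that every properly edge-coloured $n$-vertex graph with at least $Cn^{1+1/k}$ edges contains a rainbow subgraph isomorphic to $\theta_{k,t}$.
   Context: The theta graph $\theta_{k,t}$ is the union of $t$ paths of length $k$ which share the same two endpoints but are pairwise internally vertex-disjoint. An edge-colouring is proper if any two edges sharing a vertex receive different colours; a subgraph is rainbow if all its edges have distinct colours. $\mathrm{ex}^*(n,H)$ is the maximum number of edges in a properly edge-coloured $n$-vertex graph with no rainbow copy of $H$. *)

(* Defs.v *)
From Stdlib Require Import Reals.
From mathcomp Require Import all_boot.

Set Implicit Arguments.
Unset Strict Implicit.
Unset Printing Implicit Defensive.

Definition simple_graph (T : finType) (e : rel T) : Prop :=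
  (forall x y, e x y = e y x) /\ (forall x, ~~ e x x).

Definition num_edges (T : finType) (e : rel T) : nat :=
  #|[set E : {set T} | [exists x, exists y, (E == [set x; y]) && e x y]]|.

Definition proper_colouring (T : finType) (e : rel T) (c : T -> T -> nat) : Prop :=
  (forall x y, e x y -> c x y = c y x) /\
  (forall x y z, e x y -> e x z -> y != z -> c x y != c x z).

(* A rainbow copy of theta_{k,t}: distinct endpoints u, v and t paths
   p i = (p i 0, ..., p i k) of length k from u to v, pairwise internally
   vertex-disjoint (all internal vertices of all paths distinct and different
   from u, v), all of whose k*t edges get pairwise distinct colours. *)
Definition has_rainbow_theta (T : finType) (e : rel T) (c : T -> T -> nat)
    (k t : nat) : Prop :=
  exists (u v : T) (p : 'I_t -> 'I_k.+1 -> T),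
    [/\ u != v /\
        (forall i, p i ord0 = u /\ p i ord_max = v),
        (forall i (j : 'I_k.+1), 0 < j < k -> p i j != u /\ p i j != v),
        (forall i i' (j j' : 'I_k.+1), 0 < j < k -> 0 < j' < k ->
            p i j = p i' j' -> i = i' /\ j = j'),
        (forall i (j : 'I_k), e (p i (widen_ord (leqnSn k) j)) (p i (lift ord0 j))) &
        (forall i i' (j j' : 'I_k),
            c (p i (widen_ord (leqnSn k) j)) (p i (lift ord0 j)) =
            c (p i' (widen_ord (leqnSn k) j')) (p i' (lift ord0 j')) ->
            i = i' /\ j = j')].

(* Main.v *)
Require Import Defs.
From Stdlib Require Import Reals.
From mathcomp Require Import all_boot all_order all_algebra.
From mathcomp Require Import ring lra zify.
From mathcomp Require Import realalg.

(* A subgraph of minimum degree [delta >= C' n^(1/k)] is weighted by the matrix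
   N = D^(-1/2) A D^(-1/2); put H = tr N^(2k), the total weight of closed
   2k-walks, which is at least 1 because N has eigenvalue 1.  Let X_s be the
   restriction of N to one colour s (a matching), or to the edges leaving one
   vertex s.  In both cases sum_s tr (X_s X_s^T N^(2k-2)) is at most
   tr N^(2k-2) / delta, since the rows of N have square norm at most 1 / delta,
   and by log-convexity tr N^(2k-2) is at most (n^(1/k)) H.  Interpolating by
   Cauchy-Schwarz, sum_s tr (X_s N^a X_s^T N^b) is at most (small constant) H
   whenever a + b = 2k - 2 and b > 0.  These traces count the closed 2k-walks
   with a repeated vertex or colour, so almost all pairs of k-walks with common
   ends x, y form a rainbow cycle.  For some (x, y), t walks picked greedily
   are then pairwise free of conflicts, and they form the theta graph. *)

Set Implicit Arguments.
Unset Strict Implicit.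
Unset Printing Implicit Defensive.

Import Order.TTheory GRing.Theory Num.Theory.
Local Open Scope ring_scope.

(** * Cauchy-Schwarz and log-convex sequences *)

Lemma sum_cauchy_schwarz (R : realFieldType) (I : finType) (a b : I -> R) :
  (\sum_i a i * b i) ^+ 2 <= (\sum_i a i ^+ 2) * (\sum_i b i ^+ 2).
Proof.
have : 0 <= \sum_i \sum_j (a i * b j - a j * b i) ^+ 2.
  by apply: sumr_ge0 => i _; apply: sumr_ge0 => j _; exact: sqr_ge0.
have -> : \sum_i \sum_j (a i * b j - a j * b i) ^+ 2 =
  \sum_i \sum_j (a i ^+ 2 * b j ^+ 2) + \sum_i \sum_j (b i ^+ 2 * a j ^+ 2)
  - 2 * \sum_i \sum_j (a i * b i * (a j * b j)).
  rewrite mulr_sumr -big_split -sumrB; apply: eq_bigr => i _ /=.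
  rewrite mulr_sumr -big_split -sumrB; apply: eq_bigr => j _ /=.
  ring.
rewrite expr2 -!big_distrlr /=; lra.
Qed.

(* Discrete maximum principle: once such a sequence exceeds 1 it keeps growing. *)
Lemma log_convex_le1 (R : realFieldType) (m : nat) (r : nat -> R) :
  (forall i, 0 <= r i) ->
  (forall i, (i.+1 < m)%N -> r i.+1 ^+ 2 <= r i * r i.+2) ->
  r 0%N <= 1 -> r m <= 1 -> forall i, (i <= m)%N -> r i <= 1.
Proof.
move=> r0 rlc r_0 r_m.
have grow j : (j < m)%N -> r j <= 1 -> 1 < r j.+1 ->
    forall d, (j + d < m)%N -> 1 < r (j + d).+1 /\ r (j + d)%N < r (j + d).+1.
  move=> jm rj rj1; elim=> [|d IH] hd; first by rewrite addn0; split=> //; lra.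
  have [h1 h2] := IH ltac:(lia).
  have := rlc (j + d)%N ltac:(lia); rewrite addnS => h3.
  have := r0 (j + d)%N => h4.
  have h5 : r (j + d).+1 < r (j + d).+2.
    rewrite ltNge; apply/negP => h.
    have : r (j + d)%N * r (j + d).+2 <= r (j + d)%N * r (j + d).+1 by exact: ler_wpM2l.
    nra.
  by split => //; lra.
elim=> [|i IH] // im; case: leP => // ri1.
have := @grow i ltac:(lia) (IH ltac:(lia)) ri1 (m.-1 - i)%N ltac:(lia).
have -> : (i + (m.-1 - i)).+1 = m by lia.
case; lra.
Qed.

(** The ratios [q i / (l ^+ i * H)] are again log-convex and are at most 1 at both ends, so the
    maximum principle applies to them. *)
Lemma log_convex_interpolation (R : realFieldType) (m : nat) (q : nat -> R) (l H : R) :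
  0 < l -> 0 < H -> (forall i, 0 <= q i) ->
  (forall i, (i.+1 < m)%N -> q i.+1 ^+ 2 <= q i * q i.+2) ->
  q 0%N <= H -> q m <= l ^+ m * H -> forall i, (i <= m)%N -> q i <= l ^+ i * H.
Proof.
move=> l0 H0 q0 qlc qH qm i im.
have lH j : 0 < l ^+ j * H by rewrite mulr_gt0 ?exprn_gt0.
rewrite -[leRHS]mul1r -ler_pdivrMr //.
apply: (@log_convex_le1 R m (fun i => q i / (l ^+ i * H))) => //=.
- by move=> j; rewrite divr_ge0 // ltW.
- move=> j jm; rewrite expr_div_n mulf_div.
  have -> : l ^+ j * H * (l ^+ j.+2 * H) = (l ^+ j.+1 * H) ^+ 2 by rewrite !exprS; ring.
  by rewrite ler_pM2r ?invr_gt0 ?exprn_gt0 //; apply: qlc.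
- by rewrite expr0 mul1r ler_pdivrMr // mul1r.
- by rewrite ler_pdivrMr // mul1r.
Qed.

(** * Frobenius inner product and interpolation of traces *)

Section Frobenius.
Variables (R : realFieldType) (n : nat).
Implicit Types A B N : 'M[R]_n.

Lemma trace_mul_tr A B : \tr (A *m B^T) = \sum_i \sum_j A i j * B i j.
Proof.
by apply: eq_bigr => i _; rewrite mxE; apply: eq_bigr => j _; rewrite mxE.
Qed.

Lemma trace_mul_tr_ge0 A : 0 <= \tr (A *m A^T).
Proof.
rewrite trace_mul_tr; apply: sumr_ge0 => i _; apply: sumr_ge0 => j _.
by rewrite -expr2 sqr_ge0.
Qed.

(** A family of matrices is flattened to one long vector, and the sum of traces becomes a dot
    product. *)
Lemma frobenius_cauchy_schwarz (F : finType) (A B : F -> 'M[R]_n) :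
  (\sum_f \tr (A f *m (B f)^T)) ^+ 2 <=
  (\sum_f \tr (A f *m (A f)^T)) * (\sum_f \tr (B f *m (B f)^T)).
Proof.
have flat (C D : F -> 'M[R]_n) : \sum_f \tr (C f *m (D f)^T) =
    \sum_(p : F * ('I_n * 'I_n)) C p.1 p.2.1 p.2.2 * D p.1 p.2.1 p.2.2.
  rewrite -(pair_bigA _ (fun f q => C f q.1 q.2 * D f q.1 q.2)) /=.
  apply: eq_bigr => f _; rewrite trace_mul_tr.
  by rewrite (pair_bigA _ (fun i j => C f i j * D f i j)).
rewrite !flat; apply: (le_trans (sum_cauchy_schwarz _ _)).
by under eq_bigr do rewrite expr2; under [X in _ * X]eq_bigr do rewrite expr2.
Qed.

End Frobenius.

Section Sandwich.
Variables (R : realFieldType) (n : nat) (N : 'M[R]_n.+1).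
Hypothesis N_sym : N^T = N.

Lemma tr_exp_sym i : (N ^+ i)^T = N ^+ i.
Proof.
elim: i => [|i IH]; first by rewrite expr0 trmx1.
by rewrite exprS -mulmxE trmx_mul IH N_sym mulmxE -exprSr -exprS.
Qed.

Definition sandwich (X : 'M[R]_n.+1) (i j : nat) := N ^+ i *m X *m N ^+ j.

(** By cyclicity of the trace, X N^a X^T N^b has the trace of an inner product of two sandwiches,
    with freedom in how [a] and [b] are split between them. *)
Lemma trace_sandwich_mul_tr X Y i j i' j' :
  \tr (sandwich X i j *m (sandwich Y i' j')^T) =
  \tr (X *m N ^+ (j + j') *m Y^T *m N ^+ (i + i')).
Proof.
rewrite /sandwich !trmx_mul !tr_exp_sym [(i + i')%N]addnC !exprD -!mulmxE.
by rewrite -[in LHS]mulmxA [LHS]mxtrace_mulC !mulmxA mxtrace_mulC !mulmxA.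
Qed.

(** The square norms of N^i X N^(m-i), summed over the family, are log-convex in [i]; they run from
    at most [H] at 0 to at most th^(2m) H at [m], so the [i]-th is at most th^(2i) H. A general
    trace is the inner product of two of these sandwiches. *)
Lemma trace_sandwich_bound (F : finType) (X : F -> 'M[R]_n.+1) (m : nat) (th H : R) :
  0 < th <= 1 -> 0 < H ->
  \sum_f \tr (X f *m N ^+ (m + m) *m (X f)^T) <= H ->
  \sum_f \tr (X f *m (X f)^T *m N ^+ (m + m)) <= (th ^+ 2) ^+ m * H ->
  forall a b, (a + b = m + m)%N -> (0 < b)%N ->
  \sum_f \tr (X f *m N ^+ a *m (X f)^T *m N ^+ b) <= th * H.
Proof.
move=> /andP[th0 th1] H0 h0 hm a b ab b0.
pose Y i f := if (i <= m)%N then sandwich (X f) i (m - i) else 0.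
pose q i := \sum_f \tr (Y i f *m (Y i f)^T).
have Ydot i j : (i <= m)%N -> (j <= m)%N -> \sum_f \tr (Y i f *m (Y j f)^T) =
    \sum_f \tr (X f *m N ^+ (m + m - (i + j)) *m (X f)^T *m N ^+ (i + j)).
  move=> im jm; apply: eq_bigr => f _; rewrite /Y im jm trace_sandwich_mul_tr.
  by have -> : (m - i + (m - j) = m + m - (i + j))%N by lia.
have q_le i : (i <= m)%N -> q i <= (th ^+ 2) ^+ i * H.
  apply: log_convex_interpolation => //.
  - by rewrite exprn_gt0.
  - by move=> j; apply: sumr_ge0 => f _; exact: trace_mul_tr_ge0.
  - move=> j jm.
    have -> : q j.+1 = \sum_f \tr (Y j f *m (Y j.+2 f)^T).
      rewrite [RHS]Ydot ?[LHS]Ydot //; try lia.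
      by have -> : (j.+1 + j.+1 = j + j.+2)%N by lia.
    exact: frobenius_cauchy_schwarz.
  - rewrite /q Ydot // addn0 subn0.
    by under eq_bigr do rewrite expr0 mulmx1.
  - rewrite /q Ydot // subnn.
    by under eq_bigr do rewrite expr0 mulmx1.
(* Both halves of [b] serve as indices. The lower one may be 0 and gives only the bound [H]; the
   upper one is positive since [b] is, and gives [th ^+ 2 * H]. *)
have hi : (b./2 <= m)%N by lia.
have hj : (b - b./2 <= m)%N by lia.
have hb : (b./2 + (b - b./2) = b)%N by lia.
have := frobenius_cauchy_schwarz (Y b./2) (Y (b - b./2)%N).
rewrite Ydot // hb; have -> : (m + m - b = a)%N by lia.
set s := \sum_f _; rewrite -/(q _) -/(q _) => hs.
have th20 : 0 <= th ^+ 2 <= 1 by nra.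
have hq0 : 0 <= q (b - b./2)%N by apply: sumr_ge0 => f _; exact: trace_mul_tr_ge0.
have h1 : q b./2 <= H.
  apply: le_trans (q_le _ hi) _; rewrite ger_pMl //.
  by apply: exprn_ile1; case/andP: th20.
have h2 : q (b - b./2)%N <= th ^+ 2 * H.
  apply: le_trans (q_le _ hj) _; rewrite ler_pM2r //.
  have -> : (b - b./2 = (b - b./2).-1.+1)%N by lia.
  rewrite exprS ger_pMr ?exprn_gt0 //.
  by apply: exprn_ile1; case/andP: th20.
have h3 : s ^+ 2 <= (th * H) ^+ 2.
  apply: le_trans hs _; apply: le_trans (ler_wpM2r hq0 h1) _.
  apply: le_trans (ler_wpM2l (ltW H0) h2) _.
  by rewrite exprMn mulrC -mulrA -expr2.
have h4 : 0 < th * H by rewrite mulr_gt0.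
rewrite leNgt; apply/negP => h; nra.
Qed.

End Sandwich.

(** * Traces of even powers of a symmetric matrix *)

Section SymmetricPowers.
Variables (R : realFieldType) (n : nat) (N : 'M[R]_n.+1).
Hypothesis N_sym : N^T = N.

Lemma trace_pow_even i : \tr (N ^+ (i + i)) = \tr (N ^+ i *m (N ^+ i)^T).
Proof. by rewrite tr_exp_sym // exprD mulmxE. Qed.

(** Since N^k fixes [u], the inner product of N^k with u u^T is |u|^2, which is also the norm of u
    u^T. Cauchy-Schwarz then forces N^k to have norm at least 1. *)
Lemma trace_pow_ge1 (u : 'I_n.+1 -> R) (k : nat) :
  0 < \sum_i u i ^+ 2 -> (forall i, \sum_j N i j * u j = u i) ->
  1 <= \tr (N ^+ (k + k)).
Proof.
move=> u0 uN.
have uNk i j : \sum_l (N ^+ i) j l * u l = u j.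
  elim: i j => [|i IH] j.
    rewrite expr0 (bigD1 j) //= mxE eqxx mul1r big1 ?addr0 // => l lj.
    by rewrite mxE eq_sym (negPf lj) mul0r.
  rewrite exprS -[RHS]uN.
  under eq_bigr do rewrite -mulmxE mxE mulr_suml.
  rewrite exchange_big /=; apply: eq_bigr => p _.
  by rewrite -IH mulr_sumr; apply: eq_bigr => l _; rewrite mulrA.
set s := \sum_i u i ^+ 2 in u0.
have hs : s = \sum_p (N ^+ k) p.1 p.2 * (u p.1 * u p.2).
  rewrite -(pair_bigA _ (fun i j => (N ^+ k) i j * (u i * u j))) /=.
  apply: eq_bigr => i _; rewrite expr2 -{2}(uNk k i) mulr_sumr.
  by apply: eq_bigr => j _; ring.
have := sum_cauchy_schwarz (fun p : 'I_n.+1 * 'I_n.+1 => (N ^+ k) p.1 p.2)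
  (fun p => u p.1 * u p.2).
rewrite -hs -(pair_bigA _ (fun i j => (N ^+ k) i j ^+ 2)) /=.
rewrite -(pair_bigA _ (fun i j => (u i * u j) ^+ 2)) /=.
rewrite trace_pow_even trace_mul_tr.
have -> : \sum_i \sum_j (u i * u j) ^+ 2 = s ^+ 2.
  rewrite [RHS]expr2 big_distrlr /=.
  by apply: eq_bigr => i _; apply: eq_bigr => j _; rewrite exprMn.
under eq_bigr do under eq_bigr do rewrite expr2.
by rewrite ler_pMl // exprn_gt0.
Qed.

(** The even traces are log-convex. Read downwards they go from tr N^(2k+2) to the trace of the
    identity, which is the dimension and so at most [l ^+ k.+1] times the former; interpolation is
    used at the first step down. *)
Lemma trace_pow_pred_le (k : nat) (l : R) :
  0 < l -> n.+1%:R <= l ^+ k.+1 -> 1 <= \tr (N ^+ (k.+1 + k.+1)) ->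
  \tr (N ^+ (k + k)) <= l * \tr (N ^+ (k.+1 + k.+1)).
Proof.
move=> l0 ln H1.
pose q i := \tr (N ^+ (k.+1 - i) *m (N ^+ (k.+1 - i))^T).
have := @log_convex_interpolation R k.+1 q l (\tr (N ^+ (k.+1 + k.+1))) l0.
have -> : \tr (N ^+ (k + k)) = q 1%N by rewrite trace_pow_even /q subSS subn0.
rewrite -[l in X in _ -> X](expr1 l); apply => //.
- exact: lt_le_trans H1.
- by move=> i; exact: trace_mul_tr_ge0.
- move=> i ik.
  have -> : q i.+1 = \tr (N ^+ (k.+1 - i) *m (N ^+ (k.+1 - i.+2))^T).
    rewrite /q !tr_exp_sym // !mulmxE -!exprD.
    by have -> : (k.+1 - i.+1 + (k.+1 - i.+1) = k.+1 - i + (k.+1 - i.+2))%N by lia.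
  have := frobenius_cauchy_schwarz (fun _ : 'I_1 => N ^+ (k.+1 - i))
     (fun _ : 'I_1 => N ^+ (k.+1 - i.+2)).
  by rewrite !big_ord1.
- by rewrite trace_pow_even /q subn0.
- rewrite /q subnn expr0 trmx1 mulmx1 mxtrace1.
  apply: le_trans ln _; rewrite ler_peMr // exprn_ge0 // ltW //.
Qed.

Lemma mx_pow_ge0 (i : nat) : (forall x y, 0 <= N x y) -> forall x y, 0 <= (N ^+ i) x y.
Proof.
move=> N0; elim: i => [|i IH] x y; first by rewrite expr0 mxE ler0n.
by rewrite exprS -mulmxE mxE; apply: sumr_ge0 => z _; rewrite mulr_ge0.
Qed.

End SymmetricPowers.

(** * The normalised adjacency matrix and its vertex and colour masks *)

Definition colour_bound (T : finType) (c : T -> T -> nat) :=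
  (\max_(p : T * T) c p.1 p.2).+1.

Lemma colour_lt_bound (T : finType) (c : T -> T -> nat) x y : (c x y < colour_bound c)%N.
Proof. by rewrite ltnS (leq_bigmax (F := fun p => c p.1 p.2) (x, y)). Qed.

Definition masked (R : pzRingType) (n : nat) (N : 'M[R]_n) (P : rel 'I_n) : 'M[R]_n :=
  \matrix_(i, j) ((P i j)%:R * N i j).

Section WalkKernel.
Variables (R : rcfType) (n : nat) (e : rel 'I_n.+1) (c : 'I_n.+1 -> 'I_n.+1 -> nat).
Hypothesis e_simple : simple_graph e.
Hypothesis c_proper : proper_colouring e c.
Variable delta : nat.
Hypothesis delta_gt0 : (0 < delta)%N.
Hypothesis delta_le : forall i, (delta <= \sum_j e i j)%N.

Let d (i : 'I_n.+1) : R := (\sum_j e i j)%N%:R.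

(* [D^(-1/2) A D^(-1/2)], with [A] the adjacency matrix and [D] the degrees. *)
Definition kernel : 'M[R]_n.+1 :=
  \matrix_(i, j) ((e i j)%:R / (Num.sqrt (d i) * Num.sqrt (d j))).

Local Notation N := kernel.

Let d_gt0 i : 0 < d i.
Proof. by rewrite ltr0n (leq_trans delta_gt0). Qed.

Let d_sum i : d i = \sum_j (e i j)%:R.
Proof. by rewrite /d natr_sum. Qed.

Lemma kernel_sym : N^T = N.
Proof. by apply/matrixP => i j; rewrite !mxE (e_simple.1 j i) [_ * Num.sqrt _]mulrC. Qed.

Lemma kernel_ge0 i j : 0 <= N i j.
Proof. by rewrite mxE divr_ge0 // mulr_ge0 ?sqrtr_ge0. Qed.

Lemma kernel_edge i j : N i j != 0 -> e i j.
Proof. by rewrite mxE; case: (e i j) => //; rewrite mul0r eqxx. Qed.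

Lemma kernel_diag i : N i i = 0.
Proof. by rewrite mxE (negPf (e_simple.2 i)) mul0r. Qed.

(** Row [i] has [d i] nonzero entries, each of square 1 / (d i * d j), which is at most 1 / (d i *
    delta). *)
Lemma kernel_row_sqr_le i : \sum_j N i j * N i j <= delta%:R^-1.
Proof.
have dl0 : 0 < delta%:R :> R by rewrite ltr0n.
apply: (@le_trans _ _ (\sum_j (e i j)%:R / (d i * delta%:R))).
  apply: ler_sum => j _; rewrite mxE -expr2 expr_div_n exprMn.
  rewrite (sqr_sqrtr (ltW (d_gt0 i))) (sqr_sqrtr (ltW (d_gt0 j))).
  case: (e i j); last by rewrite expr0n !mul0r.
  rewrite expr1n ler_pM2l // lef_pV2 ?posrE ?mulr_gt0 // ler_pM2l //.
  by rewrite ler_nat.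
rewrite -mulr_suml -d_sum invfM mulrA divff ?mul1r //.
by rewrite gt_eqF.
Qed.

Lemma kernel_trace_ge1 k : 1 <= \tr (N ^+ (k + k)).
Proof.
(* The square roots of the degrees form a vector fixed by [N]. *)
apply: (@trace_pow_ge1 _ _ _ kernel_sym (fun i => Num.sqrt (d i))).
  rewrite (bigD1 ord0) //= ltr_wpDr //; first by apply: sumr_ge0 => j _; rewrite sqr_ge0.
  by rewrite exprn_gt0 // sqrtr_gt0.
move=> i; have hs j : Num.sqrt (d j) != 0 by rewrite gt_eqF // sqrtr_gt0.
under eq_bigr => j _.
  rewrite mxE invfM mulrA mulfVK //; over.
rewrite -mulr_suml -d_sum -{1}(sqr_sqrtr (ltW (d_gt0 i))) expr2 mulfK //.
Qed.

Definition vertex_mask (v : 'I_n.+1) := masked N (fun i _ => i == v).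
(** Colours are arbitrary naturals; indexing by an ordinal below a strict bound makes sums over
    colours finite. *)
Definition colour_mask (s : 'I_(colour_bound c)) := masked N (fun i j => c i j == s).

Lemma colour_mask_sym s : (colour_mask s)^T = colour_mask s.
Proof.
apply/matrixP => i j; rewrite !mxE (e_simple.1 j i) [Num.sqrt _ * _]mulrC.
(* The colouring is symmetric only along edges; elsewhere the entry of [N] vanishes. *)
case: (boolP (e i j)) => [eij|]; last by rewrite !mul0r !mulr0.
by rewrite (c_proper.1 _ _ eij).
Qed.

Lemma sum_colour_eq i j : \sum_(s < colour_bound c) (c i j == s)%:R = 1 :> R.
Proof.
rewrite (bigD1 (Ordinal (colour_lt_bound c i j))) //= eqxx big1 ?addr0 // => s sn.
by case: eqP => // h; case/eqP: sn; apply: val_inj.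
Qed.

(** Only row [v] of [vertex_mask v] can be nonzero, so its Gram matrix is supported at (v, v). *)
Lemma sum_vertex_mask_gram :
  \sum_v (vertex_mask v *m (vertex_mask v)^T) =
  \matrix_(i, j) ((i == j)%:R * \sum_l N i l * N i l).
Proof.
apply/matrixP => i j; rewrite summxE mxE (bigD1 i) //= big1 => [|v vi].
  rewrite addr0 mxE mulr_sumr; apply: eq_bigr => l _; rewrite !mxE eqxx mul1r.
  by case: eqP => [->|h]; rewrite 1?eq_sym ?eqxx ?mul1r //; case: eqP => // h'; 
    rewrite ?mul0r ?mulr0 //; case: h.
rewrite mxE big1 // => l _; rewrite !mxE eq_sym (negPf vi) !mul0r //.
Qed.

(* Properness makes each colour class a matching, so [colour_mask s] has at
   most one nonzero entry per column. *)
Lemma sum_colour_mask_gram :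
  \sum_s (colour_mask s *m (colour_mask s)^T) =
  \matrix_(i, j) ((i == j)%:R * \sum_l N i l * N i l).
Proof.
apply/matrixP => i j; rewrite summxE [RHS]mxE.
under eq_bigr do rewrite mxE.
rewrite exchange_big mulr_sumr /=; apply: eq_bigr => l _.
case: (eqVneq i j) => [<-|ij].
  rewrite mul1r -[RHS]mul1r -(sum_colour_eq i l) mulr_suml; apply: eq_bigr => s _.
  by rewrite [in LHS]mxE [in X in _ * X]mxE [in X in _ * X]mxE; case: eqP => _;
    rewrite ?mul1r ?mul0r.
rewrite mul0r big1 // => s _; rewrite [(_ ^T) _ _]mxE ![colour_mask _ _ _]mxE.
case: (boolP (e i l)) => [eil|nil]; last by rewrite [N i l]mxE (negPf nil) !(mul0r, mulr0).
case: (boolP (e j l)) => [ejl|njl]; last by rewrite [N j l]mxE (negPf njl) !(mul0r, mulr0).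
have [esym cp] := (e_simple.1, c_proper.2 l i j).
have := cp _ _ ij; rewrite -![e l _]esym eil ejl => /(_ isT isT).
rewrite (c_proper.1 _ _ eil) (c_proper.1 _ _ ejl).
move=> ne; case: eqP => [hi|_]; last by rewrite !mul0r.
case: eqP => [hj|_]; last by rewrite mul0r mulr0.
by rewrite hi hj eqxx in ne.
Qed.

Lemma trace_gram_le m :
  \tr ((\matrix_(i, j) ((i == j)%:R * \sum_l N i l * N i l)) *m N ^+ (m + m)) <=
  delta%:R^-1 * \tr (N ^+ (m + m)).
Proof.
rewrite /mxtrace mulr_sumr; apply: ler_sum => i _.
rewrite mxE (bigD1 i) //= big1 => [|j ji]; last first.
  by rewrite mxE eq_sym (negPf ji) !mul0r.
rewrite addr0 mxE eqxx mul1r ler_wpM2r ?kernel_row_sqr_le //.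
exact/mx_pow_ge0/kernel_ge0.
Qed.

Variables (m : nat) (th : R).
Hypotheses (th_itv : 0 < th <= 1) (m_gt0 : (0 < m)%N).
Hypothesis delta_large : n.+1%:R <= ((th ^+ 2) ^+ m * delta%:R) ^+ m.+1.

Local Notation H := (\tr (N ^+ (m.+1 + m.+1))).

(** By [delta_large], [trace_pow_pred_le] applies with l = th^(2m) delta; the factor [delta] then
    cancels against the bound on the rows. *)
Lemma trace_gram_small :
  \tr ((\matrix_(i, j) ((i == j)%:R * \sum_l N i l * N i l)) *m N ^+ (m + m)) <=
  (th ^+ 2) ^+ m * H.
Proof.
have dl0 : 0 < delta%:R :> R by rewrite ltr0n.
have [th0 th1] := andP th_itv.
apply: le_trans (trace_gram_le m) _.
rewrite mulrC ler_pdivrMr // mulrAC.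
apply: trace_pow_pred_le => //; first exact: kernel_sym.
  by rewrite mulr_gt0 // !exprn_gt0.
exact: kernel_trace_ge1.
Qed.

Let H_gt0 : 0 < H.
Proof. exact: lt_le_trans ltr01 (kernel_trace_ge1 _). Qed.

Lemma vertex_mask_trace_le a b : (a + b = m + m)%N -> (0 < b)%N ->
  \sum_v \tr (vertex_mask v *m N ^+ a *m (vertex_mask v)^T *m N ^+ b) <= th * H.
Proof.
apply: trace_sandwich_bound => //; first exact: kernel_sym.
(* Equality holds here: the term of [v] is the (v, v) entry of N N^(2m) N, and these add up to
   [H]. *)
- have -> : (m.+1 + m.+1 = (m + m).+2)%N by lia.
  rewrite le_eqVlt; apply/orP; left; apply/eqP.
  rewrite exprSr exprS -!mulmxE; apply: eq_bigr => v _.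
  have vE i j : vertex_mask v i j = (i == v)%:R * N i j by rewrite mxE.
  rewrite /mxtrace (bigD1 v) //= big1 => [|i iv]; last first.
    rewrite !mxE big1 // => l _; rewrite mxE big1 ?mul0r // => p _.
    by rewrite vE (negPf iv) !mul0r.
  rewrite addr0 !mxE; apply: eq_bigr => l _; rewrite !mxE eqxx mul1r.
  rewrite (e_simple.1 v l) [Num.sqrt (d v) * _]mulrC; congr (_ * _).
  by apply: eq_bigr => p _; rewrite vE eqxx mul1r.
- rewrite -raddf_sum -mulmx_suml sum_vertex_mask_gram; exact: trace_gram_small.
Qed.

Lemma colour_mask_trace_le a b : (a + b = m + m)%N ->
  \sum_s \tr (colour_mask s *m N ^+ a *m (colour_mask s)^T *m N ^+ b) <= th * H.
Proof.
have [th0 th1] := andP th_itv.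
have gram : \sum_s \tr (colour_mask s *m (colour_mask s)^T *m N ^+ (m + m)) <=
    (th ^+ 2) ^+ m * H.
  rewrite -raddf_sum -mulmx_suml sum_colour_mask_gram; exact: trace_gram_small.
have gram' : \sum_s \tr (colour_mask s *m N ^+ (m + m) *m (colour_mask s)^T) <= H.
  under eq_bigr do rewrite mxtrace_mulC mulmxA {1}colour_mask_sym -{2}colour_mask_sym.
  apply: le_trans gram _; rewrite ger_pMl //.
  by rewrite exprn_ile1 ?exprn_ge0 ?exprn_ile1 // ltW.
have bound := trace_sandwich_bound kernel_sym th_itv H_gt0 gram' gram.
(* Colour masks are symmetric, so [a] and [b] can trade places; when [b] is 0 the exponent [a] is
   2m, which is positive. *)
move=> ab; case: (posnP b) => [b0|]; last exact: bound.
have := @bound b a; rewrite addnC ab => /(_ erefl) hb.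
under eq_bigr => s _.
  rewrite -mulmxA mxtrace_mulC !mulmxA {1}colour_mask_sym -{2}colour_mask_sym; over.
by apply: hb; lia.
Qed.

End WalkKernel.

(** * Matrix products as sums over walks *)

Lemma prod_single_replaced (R : pzRingType) (A N : R) (k i : nat) : (i < k)%N ->
  \prod_(l < k) (if l == i :> nat then A else N) = N ^+ i * A * N ^+ (k - i.+1).
Proof.
move=> ik; rewrite -(big_mkord xpredT (fun l => if l == i then A else N)).
rewrite (big_cat_nat (n := i)) ?(ltnW ik) //= (big_ltn ik) eqxx mulrA.
congr (_ * _ * _).
  under eq_big_nat => l /andP[_ li] do rewrite (ltn_eqF li).
  by rewrite prodr_const_nat subn0.
under eq_big_nat => l /andP[li _] do rewrite (gtn_eqF li).
by rewrite prodr_const_nat.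
Qed.

Lemma prod_two_replaced (R : pzRingType) (A B N : R) (k i j : nat) :
  (i < j)%N -> (j < k)%N ->
  \prod_(l < k) (if l == i :> nat then A else if l == j :> nat then B else N) =
  N ^+ i * A * N ^+ (j - i.+1) * B * N ^+ (k - j.+1).
Proof.
move=> ij jk; pose F l := if l == i then A else if l == j then B else N.
rewrite -(big_mkord xpredT F) (big_cat_nat (n := j)) ?(ltnW jk) //= (big_ltn jk).
under eq_big_nat => l /andP[_ lj] do rewrite /F (ltn_eqF lj).
rewrite big_mkord prod_single_replaced // {1}/F eqxx (gtn_eqF ij) mulrA.
congr (_ * _).
under eq_big_nat => l /andP[jl _] do rewrite /F (gtn_eqF jl) (gtn_eqF (ltn_trans ij jl)).
by rewrite prodr_const_nat.
Qed.

Section Walks.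
Variables (R : comPzRingType) (n : nat).

Definition from_to k (x y : 'I_n) : pred {ffun 'I_k.+1 -> 'I_n} :=
  fun f => (f ord0 == x) && (f ord_max == y).

Lemma big_ffun_recl (S : Type) (idx : S) (op : Monoid.com_law idx) k
    (G : {ffun 'I_k.+1 -> 'I_n} -> S) :
  \big[op/idx]_f G f =
  \big[op/idx]_a \big[op/idx]_(g : {ffun 'I_k -> 'I_n})
     G [ffun i => if unlift ord0 i is Some j then g j else a].
Proof.
rewrite pair_big /=.
rewrite (reindex (fun p : 'I_n * {ffun 'I_k -> 'I_n} =>
   [ffun i => if unlift ord0 i is Some j then p.2 j else p.1])) //=.
exists (fun f : {ffun 'I_k.+1 -> 'I_n} => (f ord0, [ffun j => f (lift ord0 j)])).
  move=> [a g] _ /=; rewrite ffunE unlift_none; congr (_, _).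
  by apply/ffunP => j; rewrite !ffunE liftK.
move=> f _; apply/ffunP => i; rewrite ffunE.
by case: unliftP => [j ->|->] //=; rewrite ffunE.
Qed.

(** Letting the matrix vary with the step allows a mask to constrain chosen steps of a walk. *)
Lemma prod_mx_walks k (M : 'I_k -> 'M[R]_n) x y :
  (\prod_(l < k) M l) x y = \sum_(f | from_to x y f)
    \prod_(l < k) M l (f (widen_ord (leqnSn k) l)) (f (lift ord0 l)).
Proof.
elim: k M x => [|k IH] M x.
  rewrite big_ord0 mxE big_mkcond big_ffun_recl /=.
  have u0 : #|{ffun 'I_0 -> 'I_n}| = 1%N by rewrite card_ffun !card_ord.
  rewrite (bigD1 x) //= [X in _ + X]big1 ?addr0 => [|a ax]; last first.
    by rewrite big1 // => g _; rewrite /from_to !ffunE unlift_none (negPf ax).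
  rewrite (eq_bigr (fun=> (x == y)%:R)) => [|g _].
    by rewrite sumr_const cardT -cardE u0.
  rewrite /from_to !ffunE unlift_none eqxx.
  have -> : (ord_max : 'I_1) = ord0 by apply: val_inj.
  by rewrite unlift_none big_ord0; case: eqP.
rewrite big_ord_recl -mulmxE mxE [RHS]big_mkcond [RHS]big_ffun_recl [RHS](bigD1 x) //=.
rewrite [X in _ + X]big1 ?addr0 => [|a ax]; last first.
  by rewrite big1 // => g _; rewrite /from_to ffunE unlift_none (negPf ax).
under eq_bigr do rewrite IH mulr_sumr.
rewrite (exchange_big_dep xpredT) //= [RHS](eq_bigr (fun g =>
  \sum_(z | from_to z y g) (M ord0 x z * \prod_(l < k) M (lift ord0 l)
     (g (widen_ord (leqnSn k) l)) (g (lift ord0 l))))) // => g _.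
rewrite /from_to ffunE unlift_none eqxx /=.
have -> : (ord_max : 'I_k.+2) = lift ord0 ord_max by apply: val_inj.
rewrite ffunE liftK.
case: eqP => gy; last by rewrite big_pred0 // => z; rewrite andbF.
rewrite (big_pred1 (g ord0)) => [|z]; last by rewrite andbT eq_sym.
rewrite big_ord_recl !ffunE liftK.
have -> : widen_ord (leqnSn k.+1) ord0 = ord0 by apply: val_inj.
rewrite unlift_none; congr (_ * _); apply: eq_bigr => l _; rewrite !ffunE.
have -> : widen_ord (leqnSn k.+1) (lift ord0 l) = lift ord0 (widen_ord (leqnSn k) l).
  exact: val_inj.
by rewrite !liftK.
Qed.

Definition weight k (N : 'M[R]_n) (f : {ffun 'I_k.+1 -> 'I_n}) : R :=
  \prod_(l < k) N (f (widen_ord (leqnSn k) l)) (f (lift ord0 l)).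

Lemma sum_weight k (N : 'M[R]_n) x y :
  \sum_(f : {ffun 'I_k.+1 -> 'I_n} | from_to x y f) weight N f = (N ^+ k) x y.
Proof. by rewrite -prod_mx_walks prodr_const card_ord. Qed.

Lemma sum_weight_masked k (N : 'M[R]_n) (P : rel 'I_n) x y (i : 'I_k) :
  \sum_(f : {ffun 'I_k.+1 -> 'I_n} | from_to x y f)
     (P (f (widen_ord (leqnSn k) i)) (f (lift ord0 i)))%:R * weight N f =
  (N ^+ i *m masked N P *m N ^+ (k - i.+1)) x y.
Proof.
rewrite !mulmxE -prod_single_replaced // prod_mx_walks; apply: eq_bigr => f _.
rewrite /weight (bigD1 i) //= [RHS](bigD1 i) //= eqxx mxE mulrA; congr (_ * _).
by apply: eq_bigr => l li; rewrite (negPf (_ : l != i :> nat)).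
Qed.

Lemma sum_weight_masked2 k (N : 'M[R]_n) (P Q : rel 'I_n) x y (i j : 'I_k) :
  (i < j)%N ->
  \sum_(f : {ffun 'I_k.+1 -> 'I_n} | from_to x y f)
     ((P (f (widen_ord (leqnSn k) i)) (f (lift ord0 i)))%:R *
      (Q (f (widen_ord (leqnSn k) j)) (f (lift ord0 j)))%:R) * weight N f =
  (N ^+ i *m masked N P *m N ^+ (j - i.+1) *m masked N Q *m N ^+ (k - j.+1)) x y.
Proof.
move=> ij; have ji : j != i by rewrite -val_eqE gtn_eqF.
rewrite !mulmxE -prod_two_replaced // prod_mx_walks; apply: eq_bigr => f _.
rewrite /weight (bigD1 i) //= (bigD1 j) //= [RHS](bigD1 i) //= [in RHS](bigD1 j) //=.
rewrite !eqxx (gtn_eqF ij) !mxE -!mulrA [X in _ * X = _]mulrCA.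
do 4?congr (_ * _).
by apply: eq_bigr => l /andP[li lj];
  rewrite (negPf (_ : l != i :> nat)) // (negPf (_ : l != j :> nat)).
Qed.

End Walks.

(** * Conflicts between walks: their total weight and a greedy selection *)

Section Conflicts.
Variables (n : nat) (c : 'I_n.+1 -> 'I_n.+1 -> nat) (m : nat).
Local Notation k := m.+1.
Local Notation walk := {ffun 'I_k.+1 -> 'I_n.+1}.
Implicit Types f g : walk.

Definition src f (l : 'I_k) := f (widen_ord (leqnSn k) l).
Definition tgt f (l : 'I_k) := f (lift ord0 l).
Definition colour f (l : 'I_k) := c (src f l) (tgt f l).

(* Position [j.+1] of a walk is [tgt f j], so [i <= j] compares distinct positions. *)
Definition vertex_repeat f (i j : 'I_k) := (i <= j)%N && (src f i == tgt f j).
Definition colour_repeat f (i j : 'I_k) := (i < j)%N && (colour f i == colour f j).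
(** Position 0 is excluded and [src] never reaches the last position, so the two common ends do not
    count as meetings. *)
Definition vertex_meet f g (i j : 'I_k) := [&& (0 < i)%N, (0 < j)%N & src f i == src g j].
Definition colour_meet f g (i j : 'I_k) := colour f i == colour g j.

(** A defect of one walk counts as a conflict with every walk. Two or more pairwise conflict-free
    walks are therefore rainbow paths themselves. *)
Definition conflict_at f g (i j : 'I_k) :=
  [|| vertex_repeat f i j, vertex_repeat g i j, colour_repeat f i j,
      colour_repeat g i j, vertex_meet f g i j | colour_meet f g i j].

Definition conflict : rel walk := fun f g => [exists i, exists j, conflict_at f g i j].

Variables (R : realFieldType) (N : 'M[R]_n.+1).
Hypothesis N_sym : N^T = N.
Hypothesis N_ge0 : forall i j, 0 <= N i j.
Hypothesis N_diag : forall i, N i i = 0.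

Lemma weight_ge0 f : 0 <= weight N f.
Proof. exact: prodr_ge0. Qed.

(** A pair of walks with common ends is a closed 2k-walk cut at two opposite vertices; if [p] always
    holds, the value is the trace of N^(2k). *)
Definition pair_weight (p : walk -> walk -> bool) : R :=
  \sum_x \sum_y \sum_(f : walk | from_to x y f) \sum_(g : walk | from_to x y g)
    (p f g)%:R * (weight N f * weight N g).

Section MaskFamily.
Variables (F : finType) (P : F -> rel 'I_n.+1).
Local Notation X s := (masked N (P s)).

(** The closed walk along [f] and back along [g] is read from step [i] of [f]: the exponents count
    the free steps between the two masked ones and those leading back. [Q] is the transposed family,
    because masking the target of a step transposes the mask on its source. *)
Lemma pair_weight_self_masked (p : pred walk) (Q : F -> rel 'I_n.+1) (i j : 'I_k) :
  (forall f, (p f)%:R =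
     \sum_s (P s (src f i) (tgt f i))%:R * (Q s (src f j) (tgt f j))%:R :> R) ->
  (forall s, masked N (Q s) = (X s)^T) -> (i < j)%N ->
  pair_weight (fun f _ => p f) =
  \sum_s \tr (X s *m N ^+ (j - i.+1) *m (X s)^T *m N ^+ (k - j.+1 + k + i)).
Proof.
move=> pE QP ij.
transitivity (\sum_x \sum_y \sum_s
  (N ^+ i *m X s *m N ^+ (j - i.+1) *m (X s)^T *m N ^+ (k - j.+1)) x y * (N ^+ k) x y).
  apply: eq_bigr => x _; apply: eq_bigr => y _.
  under eq_bigr => f _.
    rewrite pE -mulr_sumr -mulr_sumr sum_weight mulrA; over.
  rewrite -[RHS]mulr_suml -[LHS]mulr_suml /=; congr (_ * _).
  under eq_bigr do rewrite mulr_suml.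
  rewrite exchange_big /=; apply: eq_bigr => s _.
  by rewrite -QP -sum_weight_masked2.
under eq_bigr do rewrite exchange_big /=.
rewrite exchange_big /=; apply: eq_bigr => s _.
rewrite -trace_mul_tr tr_exp_sym // -!mulmxA mxtrace_mulC -!mulmxA.
by rewrite !mulmxE -!exprD addnA.
Qed.

(** The closed walk uses step [j] of [g] backwards, hence the transpose. The first exponent counts
    the free steps through [y], the second those through [x]. *)
Lemma pair_weight_cross_masked (p : walk -> pred walk) (i j : 'I_k) :
  (forall f g, (p f g)%:R =
     \sum_s (P s (src f i) (tgt f i))%:R * (P s (src g j) (tgt g j))%:R :> R) ->
  pair_weight p =
  \sum_s \tr (X s *m N ^+ (k - i.+1 + (k - j.+1)) *m (X s)^T *m N ^+ (i + j)).
Proof.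
move=> pE; under [RHS]eq_bigr do rewrite -trace_sandwich_mul_tr // trace_mul_tr.
rewrite [RHS]exchange_big; apply: eq_bigr => x _.
rewrite [RHS]exchange_big; apply: eq_bigr => y _ /=.
under [RHS]eq_bigr do rewrite -!sum_weight_masked big_distrlr /=.
rewrite [RHS]exchange_big; apply: eq_bigr => f _ /=.
rewrite [RHS]exchange_big; apply: eq_bigr => g _ /=.
by rewrite pE mulr_suml; apply: eq_bigr => s _; rewrite mulrACA.
Qed.

End MaskFamily.

Lemma sum_walk_pairs_swap (G : walk -> walk -> R) :
  \sum_x \sum_y \sum_(f : walk | from_to x y f) \sum_(g : walk | from_to x y g) G f g =
  \sum_x \sum_y \sum_(f : walk | from_to x y f) \sum_(g : walk | from_to x y g) G g f.
Proof. by apply: eq_bigr => x _; apply: eq_bigr => y _; rewrite exchange_big. Qed.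

Lemma eq_pair_weight p q : (forall f g, p f g = q f g) -> pair_weight p = pair_weight q.
Proof.
by move=> pq; do 4?[apply: eq_bigr => ? _]; rewrite pq.
Qed.

Lemma pair_weight0 : pair_weight (fun _ _ => false) = 0.
Proof. by do 4?[apply: big1 => ? _]; rewrite mul0r. Qed.

Variable B : R.
Hypothesis B_ge0 : 0 <= B.
Hypothesis vertex_trace_le : forall a b, (a + b = m + m)%N -> (0 < b)%N ->
  \sum_v \tr (masked N (fun i _ => i == v) *m N ^+ a *m
              (masked N (fun i _ => i == v))^T *m N ^+ b) <= B.
Hypothesis colour_trace_le : forall a b, (a + b = m + m)%N ->
  \sum_(s < colour_bound c) \tr (masked N (fun i j => c i j == s) *m N ^+ a *m
              (masked N (fun i j => c i j == s))^T *m N ^+ b) <= B.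
Hypothesis mask_colour_sym : forall s : 'I_(colour_bound c),
  (masked N (fun i j => c i j == s))^T = masked N (fun i j => c i j == s).

(** Summing over the common value splits an equality between two positions into one mask for
    each. *)
Lemma eq_vertex_sum (x y : 'I_n.+1) : (x == y)%:R = \sum_v (x == v)%:R * (y == v)%:R :> R.
Proof.
rewrite (bigD1 x) //= eqxx mul1r big1 ?addr0 1?eq_sym // => v vx.
by rewrite eq_sym (negPf vx) mul0r.
Qed.

Lemma eq_colour_sum (x y x' y' : 'I_n.+1) : (c x y == c x' y')%:R =
  \sum_(s < colour_bound c) (c x y == s)%:R * (c x' y' == s)%:R :> R.
Proof.
rewrite (bigD1 (Ordinal (colour_lt_bound c x y))) //= eqxx mul1r big1 ?addr0 1?eq_sym // => s sx.
by case: eqP => h; rewrite ?mul0r //; case/eqP: sx; apply: val_inj.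
Qed.

Lemma pair_weight_vertex_repeat i j : pair_weight (fun f _ => vertex_repeat f i j) <= B.
Proof.
case: (ltngtP i j) => [ij|ji|/val_inj ij].
- rewrite (@eq_pair_weight _ (fun f _ => src f i == tgt f j)) => [|f g]; last first.
    by rewrite /vertex_repeat ltnW.
  rewrite (pair_weight_self_masked (P := fun v a _ => a == v) (Q := fun v _ a => a == v) _ _ ij).
  + by apply: vertex_trace_le; move: ij (ltn_ord j); lia.
  + by move=> f; exact: eq_vertex_sum.
  + move=> v; apply/matrixP => a b; by rewrite !mxE -[in RHS]N_sym mxE.
- rewrite (@eq_pair_weight _ (fun _ _ => false)) ?pair_weight0 // => f g.
  by rewrite /vertex_repeat leqNgt ji.
(* For i = j the repeat is a step from a vertex to itself, of weight zero because [N] has zero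
   diagonal. *)
- suff -> : pair_weight (fun f _ => vertex_repeat f i j) = 0 by [].
  do 4?[apply: big1 => ? _]; rewrite /vertex_repeat ij leqnn /=.
  case: eqP => [h|]; last by rewrite mul0r.
  by rewrite /weight (bigD1 j) //= -/(src _ _) h N_diag !mul0r mulr0.
Qed.

Lemma pair_weight_colour_repeat i j : pair_weight (fun f _ => colour_repeat f i j) <= B.
Proof.
case: (ltnP i j) => ij; last first.
  rewrite (@eq_pair_weight _ (fun _ _ => false)) ?pair_weight0 // => f g.
  by rewrite /colour_repeat ltnNge ij.
rewrite (@eq_pair_weight _ (fun f _ => colour f i == colour f j)) => [|f g]; last first.
  by rewrite /colour_repeat ij.
pose P (s : 'I_(colour_bound c)) x y := c x y == s.
rewrite (pair_weight_self_masked (P := P) (Q := P) _ _ ij).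
- by apply: colour_trace_le; move: ij (ltn_ord j); lia.
- by move=> f; exact: eq_colour_sum.
- by move=> s; rewrite mask_colour_sym.
Qed.

Lemma pair_weight_vertex_meet i j : pair_weight (fun f g => vertex_meet f g i j) <= B.
Proof.
case: (boolP ((0 < i) && (0 < j))%N) => [ij|nij]; last first.
  rewrite (@eq_pair_weight _ (fun _ _ => false)) ?pair_weight0 // => f g.
  by rewrite /vertex_meet andbA (negPf nij).
rewrite (@eq_pair_weight _ (fun f g => src f i == src g j)) => [|f g]; last first.
  by rewrite /vertex_meet andbA ij.
rewrite (pair_weight_cross_masked (P := fun v a _ => a == v) (i := i) (j := j)); last first.
  by move=> f g; exact: eq_vertex_sum.
(* The second exponent is i + j, positive because the meeting is not at the common start. *)
by apply: vertex_trace_le; move: ij (ltn_ord i) (ltn_ord j); lia.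
Qed.

Lemma pair_weight_colour_meet i j : pair_weight (fun f g => colour_meet f g i j) <= B.
Proof.
rewrite (pair_weight_cross_masked (P := fun (s : 'I_(colour_bound c)) x y => c x y == s)
  (i := i) (j := j)); last by move=> f g; exact: eq_colour_sum.
by apply: colour_trace_le; move: (ltn_ord i) (ltn_ord j); lia.
Qed.

Lemma pair_weight_conflict_at i j : pair_weight (fun f g => conflict_at f g i j) <= 6%:R * B.
Proof.
have tr i' j' := pair_weight_vertex_repeat i' j'; have cr i' j' := pair_weight_colour_repeat i' j'.
have swap (p : walk -> bool) : pair_weight (fun _ g => p g) = pair_weight (fun f _ => p f).
  rewrite /pair_weight sum_walk_pairs_swap.
  by do 4?[apply: eq_bigr => ? _]; rewrite [weight N _ * _]mulrC.
apply: (@le_trans _ _ (pair_weight (fun f _ => vertex_repeat f i j) +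
   pair_weight (fun _ g => vertex_repeat g i j) + pair_weight (fun f _ => colour_repeat f i j) +
   pair_weight (fun _ g => colour_repeat g i j) + pair_weight (fun f g => vertex_meet f g i j) +
   pair_weight (fun f g => colour_meet f g i j))); last first.
  rewrite !swap.
  have := tr i j; have := cr i j; have := pair_weight_vertex_meet i j.
  have := pair_weight_colour_meet i j; lra.
rewrite /pair_weight -!big_split; apply: ler_sum => x _ /=.
rewrite -!big_split; apply: ler_sum => y _ /=.
rewrite -!big_split; apply: ler_sum => f _ /=.
rewrite -!big_split; apply: ler_sum => g _ /=.
rewrite -!mulrDl ler_wpM2r ?mulr_ge0 ?weight_ge0 // -!natrD ler_nat /conflict_at.
by do 6!case: (_ i j) => //=.
Qed.

(** Union bound over six kinds of conflict and k^2 pairs of positions. *)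
Lemma pair_weight_conflict : pair_weight conflict <= (6 * k ^ 2)%:R * B.
Proof.
apply: (@le_trans _ _ (\sum_(q : 'I_k * 'I_k) pair_weight (fun f g => conflict_at f g q.1 q.2))).
  rewrite /pair_weight [leRHS]exchange_big; apply: ler_sum => x _ /=.
  rewrite [leRHS]exchange_big; apply: ler_sum => y _ /=.
  rewrite [leRHS]exchange_big; apply: ler_sum => f _ /=.
  rewrite [leRHS]exchange_big; apply: ler_sum => g _ /=.
  rewrite -mulr_suml ler_wpM2r ?mulr_ge0 ?weight_ge0 //.
  case: (boolP (conflict f g)) => [/existsP[i /existsP[j fg]]|_]; last exact: sumr_ge0.
  by rewrite (bigD1 (i, j)) //= fg ler_wpDr // sumr_ge0.
apply: (@le_trans _ _ (\sum_(q : 'I_k * 'I_k) 6%:R * B)).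
  by apply: ler_sum => q _; exact: pair_weight_conflict_at.
rewrite sumr_const card_prod !card_ord -[leLHS]mulr_natl mulrA -natrM.
by rewrite [(k * k)%N]mulnn [(_ * 6)%N]mulnC.
Qed.

End Conflicts.

(* Elements of conflict degree above [W / t] weigh less than [W / t] in total;
   the others can be chosen greedily, each one excluding at most [W / t]. *)
Lemma exists_conflict_free (R : realFieldType) (A : finType) (w : A -> R)
    (C : rel A) (t : nat) :
  (0 < t)%N -> (forall a, 0 <= w a) ->
  (\sum_a \sum_b (C a b)%:R * (w a * w b)) * t%:R ^+ 2 < (\sum_a w a) ^+ 2 ->
  exists g : nat -> A, (forall i, (i < t)%N -> 0 < w (g i)) /\
    (forall i j, (i < j < t)%N -> ~~ C (g i) (g j)).
Proof.
move=> t0 w0; set W := \sum_a w a => hC.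
have T0 : 0 < t%:R :> R by rewrite ltr0n.
have W0 : 0 < W.
  rewrite lt0r sumr_ge0 // andbT; apply: contraTneq hC => ->.
  rewrite expr0n -leNgt mulr_ge0 ?exprn_ge0 ?ler0n //.
  by do 2?[apply: sumr_ge0 => ? _]; rewrite !mulr_ge0.
pose cd a := \sum_b (C a b)%:R * w b.
pose heavy a := W < cd a * t%:R.
(* A heavy [a] contributes more than w(a) W / t to the conflict sum when w(a) > 0, and that sum is
   below W^2 / t^2. *)
have heavy_small : (\sum_a (heavy a)%:R * w a) * t%:R < W.
  rewrite -(ltr_pM2l W0) -expr2; apply: le_lt_trans hC.
  rewrite mulr_suml mulr_sumr mulr_suml; apply: ler_sum => a _.
  have -> : \sum_b (C a b)%:R * (w a * w b) = w a * cd a.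
    by rewrite mulr_sumr; apply: eq_bigr => b _; rewrite mulrCA.
  case: (boolP (heavy a)) => [ha|_]; last first.
    rewrite mul0r mul0r mulr0 !mulr_ge0 ?exprn_ge0 ?ler0n //.
    by apply: sumr_ge0 => b _; rewrite mulr_ge0.
  rewrite mul1r expr2 mulrA [leLHS]mulrC -!mulrA ler_wpM2l //.
  by rewrite mulrA mulrC ler_pM2r // ltW.
have [a0] : exists a0 : A, True.
  case: (pickP (fun _ : A => true)) => [a _|h0]; first by exists a.
  by move: W0; rewrite /W big_pred0 ?ltxx.
move=> _.
suff step j : (j <= t)%N -> exists g : nat -> A,
    (forall i, (i < j)%N -> 0 < w (g i) /\ ~~ heavy (g i)) /\
    (forall i i', (i < i' < j)%N -> ~~ C (g i) (g i')).
  have [g [h1 h2]] := step t (leqnn t); exists g; split=> // i it.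
  by case: (h1 i it).
elim: j => [|j IH] jt; first by exists (fun=> a0); split=> // i i'; rewrite andbF.
have [g [h1 h2]] := IH (ltnW jt).
have [a /and3P[wa ha Ca]] : exists a,
    [&& 0 < w a, ~~ heavy a & [forall i : 'I_j, ~~ C (g i) a]].
  apply/existsP; rewrite -[X in is_true X]negbK negb_exists; apply/negP => /forallP hno.
  (* Otherwise all the weight sits on heavy elements, less than W / t, or on elements in conflict
     with one of the [j] chosen, at most j W / t. As j + 1 is at most [t], this falls short of
     [W]. *)
  have : W * t%:R < W * t%:R.
    have le1 : W <= \sum_a (heavy a)%:R * w a + \sum_(i < j) cd (g i).
      rewrite /cd exchange_big -big_split; apply: ler_sum => a _ /=.
      rewrite -mulr_suml.
      have s0 : 0 <= \sum_(i < j) (C (g i) a)%:R :> R by apply: sumr_ge0.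
      have := hno a; rewrite !negb_and negbK => /or3P[].
      - rewrite -leNgt => wa; rewrite (_ : w a = 0) ?mulr0 ?addr0 //.
        by apply/eqP; rewrite eq_le wa w0.
      - by move=> ->; rewrite mul1r ler_wpDr // mulr_ge0.
      - rewrite negb_forall => /existsP[i]; rewrite negbK => Ci.
        rewrite ler_wpDl ?mulr_ge0 // ler_peMl // (bigD1 i) //= Ci ler_wpDr //.
        exact: sumr_ge0.
    apply: le_lt_trans (_ : _ <= (\sum_a (heavy a)%:R * w a) * t%:R + j%:R * W) _.
      apply: le_trans (ler_wpM2r (ltW T0) le1) _.
      rewrite mulrDl lerD2l mulr_suml mulr_natl -[j in W *+ j]card_ord -sumr_const.
      by apply: ler_sum => i _; have [_] := h1 i (ltn_ord i); rewrite -leNgt.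
    apply: lt_le_trans (_ : _ < W + j%:R * W) _; first by rewrite ltrD2r.
    by rewrite -{1}(mul1r W) -mulrDl mulrC ler_pM2l // nat1r ler_nat.
  by rewrite ltxx.
exists (fun i => if (i < j)%N then g i else a); split.
  move=> i; rewrite ltnS leq_eqVlt => /orP[/eqP->|ij]; first by rewrite ltnn.
  by rewrite ij; apply: h1.
move=> i i' /andP[ii']; rewrite ltnS leq_eqVlt => /orP[/eqP i'j|i'j].
  rewrite i'j ltnn -i'j ii'; rewrite i'j in ii'.
  exact: (forallP Ca (Ordinal ii')).
by rewrite i'j (ltn_trans ii' i'j) h2 // ii'.
Qed.

(** * From conflict-free walks to a theta graph *)

Section ThetaExtraction.
Variables (n : nat) (e : rel 'I_n.+1) (c : 'I_n.+1 -> 'I_n.+1 -> nat) (m t : nat).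
Local Notation k := m.+1.
Local Notation walk := {ffun 'I_k.+1 -> 'I_n.+1}.
Local Notation conflict := (@conflict n c m).

Lemma conflict_sym (f g : walk) : conflict f g -> conflict g f.
Proof.
move=> /existsP[i /existsP[j]]; rewrite /conflict_at.
have meet_sym : vertex_meet f g i j || colour_meet c f g i j -> conflict g f.
  move=> h; apply/existsP; exists j; apply/existsP; exists i; apply/or4P/Or44/or3P.
  case/orP: h => [/and3P[i0 j0 h]|h]; [apply: Or32|apply: Or33].
    by rewrite /vertex_meet i0 j0 eq_sym.
  by rewrite /colour_meet eq_sym.
move=> h; case: (boolP (vertex_meet f g i j || colour_meet c f g i j)) => [/meet_sym //|].
rewrite negb_or => /andP[nv nc]; apply/existsP; exists i; apply/existsP; exists j.
move: h; rewrite /conflict_at (negPf nv) (negPf nc) !orbF.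
by case/or4P => ->; rewrite /= ?orbT.
Qed.

Lemma conflict_free_theta (g : nat -> walk) (x y : 'I_n.+1) :
  (1 < t)%N -> (forall i, (i < t)%N -> from_to x y (g i)) ->
  (forall i l, (i < t)%N -> e (src (g i) l) (tgt (g i) l)) ->
  (forall i j, (i < j < t)%N -> ~~ conflict (g i) (g j)) ->
  has_rainbow_theta e c k t.
Proof.
move=> t1 gxy ge gC.
have nc (i j : 'I_t) : i != j -> ~~ conflict (g i) (g j).
  rewrite -val_eqE /= neq_ltn => /orP[ij|ji]; first by rewrite gC // ij /=.
  by apply: contra (gC j i _); [exact: conflict_sym|rewrite ji /=].
have nca (i j : 'I_t) a b : i != j -> ~~ conflict_at c (g i) (g j) a b.
  by move=> /nc; rewrite negb_exists => /forallP/(_ a); rewrite negb_exists => /forallP/(_ b).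
(* Defects of a single walk are read off from a pair, so each walk needs a partner; one exists since
   [t] is at least 2. *)
have other (i : 'I_t) : exists j : 'I_t, i != j.
  case: (posnP i) => i0.
    by exists (Ordinal t1); rewrite -val_eqE /= i0.
  by exists (Ordinal (ltnW t1)); rewrite -val_eqE /= -lt0n.
have vr (i : 'I_t) (a b : 'I_k) : (a <= b)%N -> src (g i) a != tgt (g i) b.
  move=> ab; have [j ij] := other i; have := nca i j a b ij.
  by rewrite /conflict_at !negb_or /vertex_repeat ab => /and4P[].
have cr (i : 'I_t) (a b : 'I_k) : (a < b)%N -> colour c (g i) a != colour c (g i) b.
  move=> ab; have [j ij] := other i; have := nca i j a b ij.
  by rewrite /conflict_at !negb_or /colour_repeat ab => /and4P[].
have vm (i j : 'I_t) (a b : 'I_k) : i != j -> (0 < a)%N -> (0 < b)%N ->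
    src (g i) a != src (g j) b.
  move=> ij a0 b0; have := nca i j a b ij.
  by rewrite /conflict_at !negb_or /vertex_meet a0 b0 => /and4P[_ _ _ /and3P[]].
have cm (i j : 'I_t) (a b : 'I_k) : i != j -> colour c (g i) a != colour c (g j) b.
  move=> ij; have := nca i j a b ij.
  by rewrite /conflict_at !negb_or => /and4P[_ _ _ /and3P[]].
have gx (i : 'I_t) : src (g i) ord0 = x.
  have /andP[/eqP <- _] := gxy i (ltn_ord i).
  by congr (g i _); apply: val_inj.
have gy (i : 'I_t) : tgt (g i) ord_max = y.
  have /andP[_ /eqP <-] := gxy i (ltn_ord i).
  by congr (g i _); apply: val_inj.
(* An inner position is the source of one step and the target of the previous one: meetings compare
   sources, repeats compare a source with a target. *)
have as_src (j : 'I_k.+1) : (0 < j < k)%N ->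
    exists2 l : 'I_k, l = j :> nat & forall i : 'I_t, g i j = src (g i) l.
  move=> /andP[_ jk]; exists (Ordinal jk) => // i.
  by congr (g i _); apply: val_inj.
have as_tgt (j : 'I_k.+1) : (0 < j < k)%N ->
    exists2 l : 'I_k, l.+1 = j :> nat & forall i : 'I_t, g i j = tgt (g i) l.
  move=> /andP[j0 jk]; have jk' : (j.-1 < k)%N by lia.
  exists (Ordinal jk') => [|i]; first by rewrite /= prednK.
  by congr (g i _); apply: val_inj; rewrite /= /bump /= add1n prednK.
have inner (i : 'I_t) (j j' : 'I_k.+1) : (0 < j < k)%N -> (0 < j' < k)%N ->
    (j < j')%N -> g i j <> g i j'.
  move=> hj hj' jj'; have [a aj ->] := as_src j hj; have [b bj ->] := as_tgt j' hj'.
  by apply/eqP/vr; rewrite -ltnS bj aj.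
exists x, y, (fun i j => g i j); split.
(* The ends differ because a repeat of position 0 at position [k] is also excluded. *)
- split=> [|i].
    by rewrite -(gx (Ordinal t1)) -(gy (Ordinal t1)); apply: vr.
  by have /andP[/eqP-> /eqP->] := gxy i (ltn_ord i).
- move=> i j hj; split.
    have [b bj ->] := as_tgt j hj.
    by rewrite eq_sym -(gx i); apply: vr.
  have [a aj ->] := as_src j hj.
  by rewrite -(gy i); apply: vr; rewrite -ltnS.
- move=> i i' j j' hj hj' eqg; have [ii'|ii'] := eqVneq i i'; last first.
    move: eqg; have [a aj ->] := as_src j hj; have [b bj ->] := as_src j' hj'.
    have a0 : (0 < a)%N by rewrite aj; case/andP: hj.
    have b0 : (0 < b)%N by rewrite bj; case/andP: hj'.
    by move/eqP; rewrite (negPf (vm i i' a b ii' a0 b0)).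
  split=> //; rewrite -{}ii' in eqg.
  case: (ltngtP j j') => [jj'|jj'|/val_inj //].
    by case: (inner i j j' hj hj' jj').
  by case: (inner i j' j hj' hj jj').
- by move=> i j; apply: ge.
- move=> i i' j j' eqc; have [ii'|ii'] := eqVneq i i'; last first.
    by have /eqP[] := cm i i' j j' ii'.
  split=> //; rewrite -{}ii' in eqc.
  case: (ltngtP j j') => [jj'|jj'|/val_inj //].
    by have /eqP[] := cr i j j' jj'.
  by have /eqP[] := cr i j' j jj'.
Qed.

Variables (R : rcfType) (delta : nat).
Hypothesis e_simple : simple_graph e.
Hypothesis c_proper : proper_colouring e c.
Hypothesis delta_gt0 : (0 < delta)%N.
Hypothesis delta_le : forall i, (delta <= \sum_j e i j)%N.

Lemma min_degree_theta (th : R) : (0 < m)%N -> (1 < t)%N -> 0 < th <= 1 ->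
  n.+1%:R <= ((th ^+ 2) ^+ m * delta%:R) ^+ k ->
  (6 * k ^ 2)%:R * th * t%:R ^+ 2 < 1 ->
  has_rainbow_theta e c k t.
Proof.
move=> m0 t1 th01 delta_large th_small.
have [th0 th1] := andP th01.
set N := kernel R e.
set H := \tr (N ^+ (k + k)).
have H0 : 0 < H.
  by apply: lt_le_trans ltr01 _; apply: (kernel_trace_ge1 R e_simple delta_gt0 delta_le).
have N_sym : N^T = N by exact: kernel_sym.
have tot : pair_weight N conflict <= (6 * k ^ 2)%:R * (th * H).
  apply: pair_weight_conflict => //.
  - exact: kernel_ge0.
  - exact: kernel_diag.
  - by rewrite mulr_ge0 // ltW.
  - move=> a b ab b0.
    exact: (vertex_mask_trace_le e_simple delta_gt0 delta_le th01 m0 delta_large).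
  - move=> a b ab.
    exact: (colour_mask_trace_le e_simple c_proper delta_gt0 delta_le th01 m0 delta_large).
  - exact: colour_mask_sym.
have HE : H = \sum_x \sum_y (N ^+ k) x y ^+ 2.
  rewrite /H trace_pow_even // trace_mul_tr.
  by apply: eq_bigr => x _; apply: eq_bigr => y _; rewrite expr2.
(* Averaging: summed over all (x, y), the left sides total less than [H], which is the sum of the
   right sides. *)
have [x [y hxy]] : exists x y,
    (\sum_(f : walk | from_to x y f) \sum_(g : walk | from_to x y g)
       (conflict f g)%:R * (weight N f * weight N g)) * t%:R ^+ 2 < (N ^+ k) x y ^+ 2.
  case: (boolP [exists x, exists y,
    (\sum_(f : walk | from_to x y f) \sum_(g : walk | from_to x y g)
       (conflict f g)%:R * (weight N f * weight N g)) * t%:R ^+ 2 < (N ^+ k) x y ^+ 2]).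
    by move=> /existsP[x /existsP[y h]]; exists x, y.
  rewrite negb_exists => /forallP hno.
  have : H <= pair_weight N conflict * t%:R ^+ 2.
    rewrite HE /pair_weight mulr_suml; apply: ler_sum => x _.
    rewrite mulr_suml; apply: ler_sum => y _.
    by have := hno x; rewrite negb_exists => /forallP/(_ y); rewrite -leNgt.
  have t20 : 0 <= t%:R ^+ 2 :> R by rewrite exprn_ge0.
  have := ler_wpM2r t20 tot; set B := (6 * k ^ 2)%:R in th_small tot *.
  move=> h1 h2; have := le_trans h2 h1; rewrite leNgt.
  have -> : B * (th * H) * t%:R ^+ 2 = (B * th * t%:R ^+ 2) * H by ring.
  by rewrite gtr_pMl // th_small.
(* Positive [w] then encodes both the ends of a walk and that all its steps are edges. *)
pose w (f : walk) := if from_to x y f then weight N f else 0.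
have N_ge0 := kernel_ge0 R e.
have w0 f : 0 <= w f by rewrite /w; case: ifP => // _; exact: weight_ge0.
have := @exists_conflict_free R _ w conflict t (ltnW t1) w0.
have -> : \sum_f w f = (N ^+ k) x y by rewrite -big_mkcond sum_weight.
have -> : \sum_f \sum_g (conflict f g)%:R * (w f * w g) =
    \sum_(f : walk | from_to x y f) \sum_(g : walk | from_to x y g)
       (conflict f g)%:R * (weight N f * weight N g).
  rewrite [RHS]big_mkcond; apply: eq_bigr => f _ /=; rewrite /w.
  case: ifP => _; last by rewrite big1 // => g _; rewrite mul0r mulr0.
  rewrite [RHS]big_mkcond; apply: eq_bigr => g _ /=.
  by case: ifP => _ //; rewrite !mulr0.
move=> /(_ hxy)[g [gw gC]].
have gP i : (i < t)%N -> from_to x y (g i) /\ weight N (g i) != 0.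
  by move=> it; have := gw i it; rewrite /w; case: ifP => _; [move=> /lt0r_neq0|rewrite ltxx].
apply: (@conflict_free_theta g x y) => // [i it|i l it]; first by case: (gP i it).
have [_] := gP i it; rewrite /weight prodf_seq_neq0 => /allP/(_ l).
by rewrite mem_index_enum => /(_ isT) /kernel_edge.
Qed.

End ThetaExtraction.

(** * Reduction to large minimum degree *)

Lemma has_rainbow_theta_inj (T' T : finType) (h : T' -> T) (e : rel T)
    (c : T -> T -> nat) (k t : nat) : injective h ->
  has_rainbow_theta (fun x y => e (h x) (h y)) (fun x y => c (h x) (h y)) k t ->
  has_rainbow_theta e c k t.
Proof.
move=> h_inj [u [v [p [[uv ends] inner disj edges cols]]]].
exists (h u), (h v), (fun i j => h (p i j)); split.
- split=> [|i]; first by apply: contraNneq uv => /h_inj ->.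
  by have [-> ->] := ends i.
- move=> i j /(inner i)[pu pv].
  by split; [apply: contra_neq pu|apply: contra_neq pv]; exact: h_inj.
- by move=> i i' j j' hj hj' /h_inj; exact: disj.
- by move=> i j; exact: edges.
- by move=> i i' j j'; exact: cols.
Qed.

(* In a minimal [S] spanning more than [d #|S|] edges, deleting a vertex
   destroys more than [d] of them. *)
Lemma exists_min_degree_subset (T : finType) (e : rel T) (d : nat) :
  simple_graph e -> (2 * d * #|T| < \sum_x \sum_y e x y)%N ->
  exists2 S : {set T}, S != set0 &
    forall x, x \in S -> (d < \sum_(y in S) e x y)%N.
Proof.
move=> [e_sym e_irr] dense.
pose a (S : {set T}) := (\sum_(x in S) \sum_(y in S) e x y)%N.
have [|S] := @ex_minset _ (fun S : {set T} => 2 * d * #|S| < a S)%N.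
  have sumT (F : T -> nat) : (\sum_(x in [set: T]) F x = \sum_x F x)%N.
    by apply: eq_bigl => x; rewrite inE.
  exists setT; rewrite cardsT /a sumT.
  by under eq_bigr do rewrite sumT.
move=> /minsetP[aS Smin]; exists S.
  by apply: contraTneq aS => ->; rewrite /a cards0 big_set0 muln0.
move=> x xS; rewrite ltnNge; apply/negP => deg.
have : S :\ x = S.
  apply: Smin; last exact: subD1set.
  have aE : a S = (a (S :\ x) + 2 * \sum_(y in S) e x y)%N.
    rewrite /a (big_setD1 x) //=.
    under [X in (_ + X = _)%N]eq_bigr do rewrite (big_setD1 x) //=.
    rewrite big_split /= addnA addnC; congr (_ + _)%N.
    rewrite mul2n -addnn; congr (_ + _)%N.
    rewrite [RHS](big_setD1 x) //= (negPf (e_irr x)).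
    by apply: eq_bigr => y _; rewrite e_sym.
  have := cardsD1 x S; rewrite xS => cS.
  by move: aS; rewrite aE cS; lia.
by move/setP/(_ x); rewrite !inE eqxx xS.
Qed.

Lemma set_enumeration (T : finType) (S : {set T}) : S != set0 ->
  exists n (h : 'I_n.+1 -> T), [/\ #|S| = n.+1, injective h, forall i, h i \in S &
    forall F : T -> nat, \sum_(y in S) F y = \sum_i F (h i)].
Proof.
rewrite -card_gt0 => S0.
have : exists h : 'I_#|S| -> T, [/\ injective h, forall i, h i \in S &
    forall F : T -> nat, \sum_(y in S) F y = \sum_i F (h i)].
  exists (fun i => enum_val i); split; [exact: enum_val_inj|exact: enum_valP|].
  by move=> F; rewrite big_enum_val.
by move: S0; case: #|S| => // n _ [h [h1 h2 h3]]; exists n, h.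
Qed.

(** Here k = m + 1 and th = 1 / L with L = 6 k^2 t^2 + 1. The factor L^(2m) offsets th^(2m) in the
    degree condition, and 2 pays for passing to a subgraph of large minimum degree. *)
Definition density_constant (m t : nat) := (2 * ((6 * m.+1 ^ 2 * t ^ 2).+1 ^ 2) ^ m)%N.

Lemma dense_graph_theta (T : finType) (e : rel T) (c : T -> T -> nat) (m t : nat) :
  (0 < m)%N -> (1 < t)%N -> simple_graph e -> proper_colouring e c -> (0 < #|T|)%N ->
  (density_constant m t ^ m.+1 * #|T| ^ m.+2 <= (\sum_x \sum_y e x y) ^ m.+1)%N ->
  has_rainbow_theta e c m.+1 t.
Proof.
move=> m0 t1 e_simple c_proper T0; set a := (\sum_x _)%N => dense.
set L := (6 * m.+1 ^ 2 * t ^ 2).+1.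
have a0 : (0 < a)%N.
  rewrite -(@ltn_exp2r _ _ m.+1) // exp0n //; apply: leq_trans dense.
  by rewrite muln_gt0 !expn_gt0 T0 /density_constant muln_gt0 !expn_gt0.
(* The predecessor makes [d] the largest integer with 2 d |T| strictly below [a]. *)
pose d := (a.-1 %/ (2 * #|T|))%N.
have T20 : (0 < 2 * #|T|)%N by lia.
have dlow : (2 * d * #|T| < a)%N.
  have := leq_divM a.-1 (2 * #|T|); rewrite -/d; lia.
have dup : (a <= 2 * #|T| * d.+1)%N.
  have := ltn_ceil a.-1 T20; rewrite -/d; lia.
have [S S0 Sdeg] := exists_min_degree_subset e_simple dlow.
have [n [h [cS h_inj hS hsum]]] := set_enumeration S0.
apply: (has_rainbow_theta_inj h_inj).
have L0 : 0 < L%:R :> realalg by rewrite ltr0n.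
(* Square roots of degrees call for a real closed field; the real algebraic numbers serve. *)
apply: (@min_degree_theta _ _ _ _ _ realalg d.+1 _ _ _ _ L%:R^-1) => //.
- by split=> *; [exact: e_simple.1|exact: e_simple.2].
- split=> [x y|x y z exy exz yz]; first exact: c_proper.1.
  by apply: c_proper.2 => //; apply: contra_neq yz; exact: h_inj.
- by move=> i; rewrite -(hsum (fun y => e (h i) y : nat)); apply: Sdeg.
- by rewrite invr_gt0 L0 invf_le1 // ler1n.
- rewrite !exprVn mulrC exprMn exprVn ler_pdivlMr ?exprn_gt0 //.
  rewrite -!natrX -natrM ler_nat.
  have Sn : (n.+1 <= #|T|)%N by rewrite -cS max_card.
  apply: (@leq_trans (#|T| * ((L ^ 2) ^ m) ^ m.+1)); first by rewrite leq_mul2r Sn orbT.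
  (* Multiplying by (2 |T|)^k turns (d + 1)^k into the [k]-th power of 2 |T| (d + 1), which is at
     least a^k. *)
  rewrite -(@leq_pmul2l (2 ^ m.+1 * #|T| ^ m.+1)) ?muln_gt0 ?expn_gt0 ?T0 //.
  apply: leq_trans (_ : _ <= a ^ m.+1)%N _.
    apply: leq_trans dense; rewrite /density_constant -/L [in X in (_ <= X)%N]expnMn.
    by rewrite [(#|T| ^ m.+2)%N]expnS; lia.
  by rewrite -!expnMn leq_exp2r.
- rewrite mulrAC ltr_pdivrMr // mul1r -natrX -natrM ltr_nat.
  by [].
Qed.

Lemma num_edges_le (T : finType) (e : rel T) : (num_edges e <= \sum_x \sum_y e x y)%N.
Proof.
rewrite pair_big /= -big_mkcond sum1_card.
apply: leq_trans (leq_imset_card (fun p : T * T => [set p.1; p.2]) _).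
apply/subset_leq_card/subsetP => E; rewrite inE.
move=> /existsP[x /existsP[y /andP[/eqP-> exy]]].
by apply/imsetP; exists (x, y).
Qed.

(* Real exponents and the final bound *)
Local Close Scope ring_scope.

Lemma INR_expn (a b : nat) : INR (a ^ b) = pow (INR a) b.
Proof. by elim: b => [|b IH]; rewrite ?expn0 // expnS mult_INR IH. Qed.

(* For [T] empty, Stdlib's junk value [Rpower 0 y = 1] makes the hypothesis false. *)
Lemma Rpower_bound_nat (C n E k : nat) : 0 < C -> 0 < k ->
  Rle (Rmult (INR C) (Rpower (INR n) (Rplus 1 (Rinv (INR k))))) (INR E) ->
  (n = 0 -> E = 0) -> 0 < n /\ C ^ k * n ^ k.+1 <= E ^ k.
Proof.
move=> C0 k0 hE En.
have INR_gt0 a : 0 < a -> Rlt 0 (INR a) by move/ssrnat.ltP/lt_0_INR.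
have P0 := exp_pos (Rmult (Rplus 1 (Rinv (INR k))) (ln (INR n))).
rewrite -/(Rpower _ _) in P0.
have n0 : 0 < n.
  rewrite lt0n; apply/eqP => n0; move: hE; rewrite (En n0).
  by apply: Rlt_not_le; apply: Rmult_lt_0_compat => //; apply: INR_gt0.
split=> //; apply/ssrnat.leP/INR_le; rewrite mult_INR !INR_expn.
(* Taking [k]-th powers clears the real exponent, since (1 + 1/k) k = k + 1. *)
have -> : pow (INR n) k.+1 = pow (Rpower (INR n) (Rplus 1 (Rinv (INR k)))) k.
  rewrite -(Rpower_pow k (Rpower _ _)) // Rpower_mult -(Rpower_pow k.+1); last exact: INR_gt0.
  congr Rpower; rewrite S_INR Rmult_plus_distr_r Rmult_1_l Rinv_l //.
  by apply: Rgt_not_eq; apply: INR_gt0.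
rewrite -Rpow_mult_distr; apply: pow_incr; split=> //.
by apply: Rmult_le_pos; [exact: pos_INR|exact: Rlt_le].
Qed.

Theorem theorem1p5 (k t : nat) (hk : 2 <= k) (ht : 2 <= t) :
  exists C : R,
    forall (T : finType) (e : rel T) (c : T -> T -> nat),
      simple_graph e -> proper_colouring e c ->
      Rle (Rmult C (Rpower (INR #|T|) (Rplus 1 (Rinv (INR k))))) (INR (num_edges e)) ->
      has_rainbow_theta e c k t.
Proof.
case: k hk => // m m0; exists (INR (density_constant m t)) => T e c e_simple c_proper.
have C0 : 0 < density_constant m t by rewrite muln_gt0 !expn_gt0.
move=> /(Rpower_bound_nat C0 (ltn0Sn m)) [T0|T0 dense].
  apply/eqP; rewrite -leqn0; apply: leq_trans (num_edges_le e) _.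
  by rewrite big1 // => x; have := fintype0 x; rewrite T0.
apply: dense_graph_theta => //; apply: leq_trans dense _.
by rewrite leq_exp2r // num_edges_le.
Qed.
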